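(* Let $A,\beta,\gamma$ be real constants, $n$ a natural number, and let $a_0$ be the Laguerre polynomial, i.e. a nonzero polynomial solution of degree $n$ of $$xf''+(A+1-x)f'+nf=0 .$$ Consider planar quadratic systems $$\dot x=p_2(x),\qquad \dot y=y^2+(q_{11}x+q_{10})y+q_{22}x^2+q_{21}x+q_{20},\qquad p_2(x)=p_{22}x^2+p_{21}x+p_{20},$$ for which the equation $p_2w''+rw'+\kappa w=0$, with $r(x)=(2p_{22}+q_{11}-2\beta)x+p_{21}+q_{10}-2\gamma$ and $\kappa$ constant, is the Laguerre equation $xw''+(A+1-x)w'+nw=0$ (i.e. $p_2=x$, $r=A+1-x$, $\kappa=n$). (1) The most general such system which admits the invariant algebraic curve $a_0\bigl(y-((\beta-q_{11})x+\gamma-q_{10})\bigr)+p_2a_0'=0$ with cofactor $y+\beta x+\gamma$ (that is, the only one for which this curve is invariant with this cofactor) is $$\begin{aligned} \dot x={}&x,\\ \dot y={}&y^2+(2\beta-1)xy+(2\gamma+A)y+(\beta-1)\beta\,x^2\\ &+\bigl(\beta(A+2\gamma-1)+n+1-\gamma\bigr)x+A\gamma+\gamma^2 . \end{aligned}\qquad (L)$$ (2) Consider the system, in variables $(X,y)$ with parameters $a,b,c,\tilde\beta,\gamma$, $$\begin{aligned} \dot X={}&X(1-X),\\ \dot y={}&y^2+(2\tilde\beta-a-b+1)Xy+(c-1+2\gamma)y+\gamma(\gamma+c-1)\\ &+\bigl(\tilde\beta^2+(2-a-b)\tilde\beta+(a-1)(b-1)\bigr)X^2+\bigl(c\tilde\beta-ab+(1-\gamma)(-2\tilde\beta-1+a+b)\bigr)X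 . \end{aligned}$$ Under the change $X=x/b$, $\tilde\beta=\beta b$, $a=-n$, $c=A+1$, and letting the parameter $b$ tend to infinity, this system becomes system $(L)$.
   Context: For a polynomial vector field associated with $\dot x=P(x,y)$, $\dot y=Q(x,y)$, of degree $m=\max\{\deg P,\deg Q\}$, and a polynomial $g(x,y)$, the curve $g=0$ is an invariant algebraic curve with cofactor $K$ if $P\,\partial g/\partial x+Q\,\partial g/\partial y=Kg$, where $K$ is a polynomial of degree at most $m-1$. Primes denote derivatives with respect to $x$. In (2) the limit is meant coefficientwise: for fixed $n,A,\beta,\gamma$, the coefficients of the transformed system in the variables $(x,y)$ converge as $b\to\infty$ to those of $(L)$. *)

(* Defs.v *)
(* MathComp-Analysis world. *)
From HB Require Import structures.
From mathcomp Require Import all_boot all_order all_algebra.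
From mathcomp Require Import all_classical all_reals all_analysis.
(* The notations of mpoly clash with those of MathComp-Analysis. *)
From mathcomp Require Import -(notations) mpoly.

Set Implicit Arguments.
Unset Strict Implicit.
Unset Printing Implicit Defensive.

Import Order.TTheory GRing.Theory Num.Theory numFieldNormedType.Exports.
Local Open Scope classical_set_scope.
Local Open Scope ring_scope.

(* As in mpoly.v, msize p is the total degree of p plus one, and msize 0 = 0. *)
Local Notation msize p := (@mmeasure _ _ mdeg p).

Section PlanarVectorFields.
Variable R : realType.
Implicit Types (f : {poly R}) (g K : mpoly 2 R).

Definition varx : mpoly 2 R := mpolyX R (mnm1 (0 : 'I_2)).
Definition vary : mpoly 2 R := mpolyX R (mnm1 (1 : 'I_2)).
Definition cst (c : R) : mpoly 2 R := mpolyC 2 c.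
Definition poly_in_x f : mpoly 2 R := (map_poly (@mpolyC 2 R) f).[varx].

(* The vector field of x' = vfP(x, y), y' = vfQ(x, y). *)
Record vfield := VField { vfP : mpoly 2 R; vfQ : mpoly 2 R }.

Definition vfdegree (V : vfield) : nat :=
  (maxn (msize (vfP V)) (msize (vfQ V))).-1.

(* msize K <= m encodes deg K <= m - 1. *)
Definition invariant_curve (V : vfield) g K : Prop :=
  (msize K <= vfdegree V)%N /\
  vfP V * mderiv (0 : 'I_2) g + vfQ V * mderiv (1 : 'I_2) g = K * g.

Definition cvg_coeffwise (F : set_system R) (V : R -> vfield) (W : vfield) :
    Prop :=
  forall m : multinom 2,
    ((mcoeff m (vfP (V t)) @[t --> F] --> mcoeff m (vfP W)) /\
     (mcoeff m (vfQ (V t)) @[t --> F] --> mcoeff m (vfQ W))).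

(* The field V, given in variables (X, y), rewritten in the variables (x, y)
   with X = x / b: since x = b X, one has x' = b X'. *)
Definition subst_div (b : R) (g : mpoly 2 R) : mpoly 2 R :=
  comp_mpoly [tuple cst b^-1 * varx; vary] g.
Definition rescale_x (b : R) (V : vfield) : vfield :=
  VField (cst b * subst_div b (vfP V)) (subst_div b (vfQ V)).

(* The equation ode_p w'' + ode_r w' + ode_k w = 0. *)
Record ode2 := ODE2 { ode_p : {poly R}; ode_r : {poly R}; ode_k : R }.

Definition ode2_solution (E : ode2) f : Prop :=
  ode_p E * deriv (deriv f) + ode_r E * deriv f + (ode_k E)%:P * f = 0.

Definition laguerre_ode (A : R) (n : nat) : ode2 :=
  ODE2 'X ((A + 1)%:P - 'X) n%:R.

Definition laguerre_poly (A : R) (n : nat) f : Prop :=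
  [/\ f != 0, size f = n.+1 & ode2_solution (laguerre_ode A n) f].

Record qcoeffs := QCoeffs {
  p22 : R; p21 : R; p20 : R;
  q11 : R; q10 : R;
  q22 : R; q21 : R; q20 : R }.

Definition p2 (s : qcoeffs) : {poly R} :=
  (p22 s)%:P * 'X^2 + (p21 s)%:P * 'X + (p20 s)%:P.

Definition quadratic_system (s : qcoeffs) : vfield :=
  VField (poly_in_x (p2 s))
    (vary ^+ 2 + (cst (q11 s) * varx + cst (q10 s)) * vary
     + cst (q22 s) * varx ^+ 2 + cst (q21 s) * varx + cst (q20 s)).

Definition associated_ode (s : qcoeffs) (beta gamma kappa : R) : ode2 :=
  ODE2 (p2 s)
    ((2 * p22 s + q11 s - 2 * beta)%:P * 'X
     + (p21 s + q10 s - 2 * gamma)%:P)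
    kappa.

Definition curve (s : qcoeffs) (beta gamma : R) (a0 : {poly R}) : mpoly 2 R :=
  poly_in_x a0
    * (vary - (cst (beta - q11 s) * varx + cst (gamma - q10 s)))
  + poly_in_x (p2 s) * poly_in_x (deriv a0).

Definition linear_cofactor (beta gamma : R) : mpoly 2 R :=
  vary + cst beta * varx + cst gamma.

Definition laguerre_system (A beta gamma : R) (n : nat) : vfield :=
  VField varx
    (vary ^+ 2 + cst (2 * beta - 1) * varx * vary
     + cst (2 * gamma + A) * vary
     + cst ((beta - 1) * beta) * varx ^+ 2
     + cst (beta * (A + 2 * gamma - 1) + n%:R + 1 - gamma) * varx
     + cst (A * gamma + gamma ^+ 2)).

Definition hypergeometric_system (a b c beta gamma : R) : vfield :=
  VField (varx * (1 - varx))
    (vary ^+ 2 + cst (2 * beta - a - b + 1) * varx * vary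
     + cst (c - 1 + 2 * gamma) * vary
     + cst (gamma * (gamma + c - 1))
     + cst (beta ^+ 2 + (2 - a - b) * beta + (a - 1) * (b - 1)) * varx ^+ 2
     + cst (c * beta - a * b + (1 - gamma) * (- 2 * beta - 1 + a + b))
       * varx).

End PlanarVectorFields.

(* Main.v *)
From mathcomp Require Import all_boot all_order all_algebra.
From mathcomp Require Import all_classical all_reals all_analysis.
From mathcomp Require Import ring lra.
From mathcomp Require Import -(notations) mpoly.
(* Imported last, so that cst denotes constant polynomials rather than
   constant functions. *)
Require Import Defs.

(** Part (1) rests on one polynomial identity.  Write l for the line
    (beta - q11) x + (gamma - q10), g = a (y - l) + p2 a' for the curve and K
    for its intended cofactor.  If a solves p2 w'' + r w' + kappa w = 0, the
    equation eliminates a'' from the defect P g_x + Q g_y - K g; the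
    coefficients of r are exactly those for which the terms in a' then cancel,
    and the defect becomes a (Q - Q0), where
    Q0 = K (y - l) + (beta - q11 + kappa) p2 no longer involves a
    ([curve_defect]).  As a <> 0 and polynomials form an integral domain, the
    curve is invariant exactly when Q = Q0 ([invariant_curve_quadraticP]); the
    degree bound on K holds because Q always contains y^2.  For
    the Laguerre equation the data p2, q11, q10 and kappa are forced
    ([associated_ode_laguerre]), and Q0 is then the second component of (L)
    ([laguerre_system_factor]).

    For part (2), both components of the rescaled hypergeometric system are
    polynomials in u = 1/b of degree at most two, with coefficients that do not
    depend on b; their constant terms are the components of (L)
    ([rescale_hypergeometric_system]).  Letting u tend to 0 coefficient by
    coefficient gives the limit ([cvg_coeffwise_inv_quadratic]). *)

Set Implicit Arguments.
Unset Strict Implicit.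
Unset Printing Implicit Defensive.
Import Order.TTheory GRing.Theory Num.Theory numFieldNormedType.Exports.
Local Open Scope classical_set_scope.
Local Open Scope ring_scope.

(** * Univariate polynomials as polynomials in x and y *)

Section PolyInX.
Variable R : realType.
Implicit Types (f : {poly R}) (c : R).

Lemma poly_in_xD f1 f2 : poly_in_x (f1 + f2) = poly_in_x f1 + poly_in_x f2.
Proof. by rewrite /poly_in_x rmorphD hornerD. Qed.

Lemma poly_in_xM f1 f2 : poly_in_x (f1 * f2) = poly_in_x f1 * poly_in_x f2.
Proof. by rewrite /poly_in_x rmorphM hornerM. Qed.

Lemma poly_in_xC c : poly_in_x c%:P = cst c.
Proof. by rewrite /poly_in_x map_polyC hornerC. Qed.

Lemma poly_in_xX : poly_in_x 'X = varx R.
Proof. by rewrite /poly_in_x map_polyX hornerX. Qed.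

Lemma poly_in_x0 : poly_in_x 0 = 0 :> mpoly 2 R.
Proof. by rewrite /poly_in_x rmorph0 horner0. Qed.

Lemma poly_in_x_eq0 f : (poly_in_x f == 0) = (f == 0).
Proof.
apply/eqP/eqP => [f0|->]; last exact: poly_in_x0.
apply/polyP => k; rewrite coef0.
case: (ltnP k (size f)) => [ltk|]; last by move/(nth_default 0).
(* The coefficient of x^k in poly_in_x f is f`_k. *)
have := congr1 (mcoeff (mnm_muln (mnm1 (0 : 'I_2)) k)) f0.
rewrite /poly_in_x horner_coef size_map_poly_id0; last first.
  rewrite mpolyC_eq0 lead_coef_eq0.
  by apply: contraTneq ltk => ->; rewrite size_poly0.
rewrite mcoeff0 raddf_sum /= (bigD1 (Ordinal ltk)) //= big1 => [|i ne_ik].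
  by rewrite coef_map /= mcoeffCM mcoeffXn eqxx mulr1 addr0.
rewrite coef_map /= mcoeffCM mcoeffXn -[RHS](mulr0 (f`_i)); congr (_ * _).
apply/eqP; rewrite pnatr_eq0 eqb0; apply: contraNneq ne_ik => /mnmP/(_ 0).
by rewrite !mulmnE !mnm1E eqxx !mul1n => eq_ik; apply/eqP/val_inj.
Qed.

Lemma mderiv_var (i j : 'I_2) : mderiv i (mpolyX R (mnm1 j)) = (i == j)%:R.
Proof.
rewrite mderivX mnm1E eq_sym; case: eqP => [->|_]; last by rewrite scale0r.
by rewrite scale1r -[X in mnm_sub X _]add0m addmK mpolyX0.
Qed.

Lemma mderivx_poly_in_x f : mderiv (0 : 'I_2) (poly_in_x f) = poly_in_x f^`().
Proof.
elim/poly_ind: f => [|f c IHf]; first by rewrite deriv0 poly_in_x0 mderiv0.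
rewrite derivMXaddC !poly_in_xD !poly_in_xM poly_in_xX poly_in_xC.
by rewrite mderivD mderivM mderivC IHf mderiv_var /=; ring.
Qed.

Lemma mderivy_poly_in_x f : mderiv (1 : 'I_2) (poly_in_x f) = 0.
Proof.
elim/poly_ind: f => [|f c IHf]; first by rewrite poly_in_x0 mderiv0.
rewrite poly_in_xD poly_in_xM poly_in_xX poly_in_xC.
by rewrite mderivD mderivM mderivC IHf mderiv_var /=; ring.
Qed.

End PolyInX.

(** * The invariant curve *)

Section Curve.
Variable R : realType.
Implicit Types (s : qcoeffs R) (beta gamma kappa A : R) (a : {poly R}).

(** The defect is p2 times the differential equation for a, which vanishes,
    plus a multiple of a: the p2 a' terms of the two sides agree because
    K = y + beta x + gamma equals y - l + p2' - r. *)
Lemma curve_defect s beta gamma kappa a :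
    ode2_solution (associated_ode s beta gamma kappa) a ->
  let V := quadratic_system s in
  let g := curve s beta gamma a in
  let K := linear_cofactor beta gamma in
  let l := cst (beta - q11 s) * varx R + cst (gamma - q10 s) in
  vfP V * mderiv (0 : 'I_2) g + vfQ V * mderiv (1 : 'I_2) g - K * g
  = poly_in_x a *
    (vfQ V - (K * (vary R - l) + cst (beta - q11 s + kappa) * poly_in_x (p2 s))).
Proof.
move=> sol V g K l; have {sol} := congr1 (@poly_in_x R) sol.
have dp2 : poly_in_x (p2 s)^`() = cst (2 * p22 s) * varx R + cst (p21 s).
  rewrite -mderivx_poly_in_x /p2 !(poly_in_xD, poly_in_xM) !poly_in_xC.
  by rewrite poly_in_xX !(mderivD, mderivM) /cst !mderivC mderiv_var /=; ring.
rewrite {}/g {}/K {}/l /curve /linear_cofactor [vfP V]/=; move: (vfQ V) => Q.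
rewrite poly_in_x0 [ode_p _]/= [ode_r _]/= [ode_k _]/=.
(* From here on p2 enters only through the value of its derivative. *)
move: (p2 s) dp2 => p dp2.
rewrite !(poly_in_xD, poly_in_xM) !poly_in_xC poly_in_xX => sol.
rewrite !(mderivD, mderivB, mderivN, mderivM) /cst !mderivC.
rewrite !mderivx_poly_in_x !mderivy_poly_in_x !mderiv_var dp2 /=.
apply/eqP; rewrite -subr_eq0; apply/eqP.
by rewrite -[RHS](mulr0 (poly_in_x p)) -[X in _ = _ * X]sol /cst; ring.
Qed.

(** The monomial y^2 occurs in every quadratic system, which therefore has
    degree at least two whatever its parameters. *)
Lemma vfdegree_quadratic_system s : (2 <= vfdegree (quadratic_system s))%N.
Proof.
pose yy : multinom 2 := mnm_muln (mnm1 (1 : 'I_2)) 2.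
suff : yy \in msupp (vfQ (quadratic_system s)).
  move/(@msize_mdeg_lt 2 R); rewrite mdegMn mdeg1 mul1n => lt2.
  rewrite /vfdegree -ltnS.
  exact: leq_trans lt2 (leq_trans (leq_maxr _ _) (leqSpred _)).
rewrite mcoeff_msupp /=.
have coef_xM (k : 'I_2) : mcoeff yy (varx R * mpolyX R (mnm1 k)) = 0.
  rewrite -mpolyXD mcoeffX; case: eqP => // /mnmP/(_ 0).
  by rewrite mnmDE mulmnE !mnm1E.
have coef_x : mcoeff yy (varx R) = 0.
  by rewrite mcoeffX; case: eqP => // /mnmP/(_ 0); rewrite mulmnE !mnm1E.
have coef_y : mcoeff yy (vary R) = 0.
  by rewrite mcoeffX; case: eqP => // /mnmP/(_ 1); rewrite mulmnE !mnm1E.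
have yy_neq0 : (yy == mnm0) = false.
  by apply/eqP => /mnmP/(_ 1); rewrite mulmnE mnm1E mnm0E.
rewrite mulrDl -mulrA !mcoeffD !mcoeffCM mcoeffC !coef_xM coef_x coef_y.
by rewrite mcoeffXn eqxx yy_neq0 !mulr0 !addr0 oner_eq0.
Qed.

Lemma msize_linear_cofactor beta gamma :
  (@mmeasure 2 R mdeg (linear_cofactor beta gamma) <= 2)%N.
Proof.
have size_var (i : 'I_2) : @mmeasure 2 R mdeg (mpolyX R (mnm1 i)) = 2%N.
  by rewrite msizeX mdeg1.
apply: leq_trans (mmeasureD_le _ _ _) _; rewrite geq_max mmeasureC.
rewrite [X in _ && X](leq_trans (leq_b1 _)) // andbT.
apply: leq_trans (mmeasureD_le _ _ _) _; rewrite geq_max size_var leqnn /=.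
rewrite /cst mul_mpolyC.
by apply: leq_trans (mmeasureZ_le _ _ _) _; rewrite size_var.
Qed.

(** Cancelling the nonzero factor a of the defect determines Q. *)
Lemma invariant_curve_quadraticP s beta gamma kappa a : a != 0 ->
    ode2_solution (associated_ode s beta gamma kappa) a ->
  let K := linear_cofactor beta gamma in
  let l := cst (beta - q11 s) * varx R + cst (gamma - q10 s) in
  invariant_curve (quadratic_system s) (curve s beta gamma a) K <->
  vfQ (quadratic_system s) =
    K * (vary R - l) + cst (beta - q11 s + kappa) * poly_in_x (p2 s).
Proof.
move=> a_neq0 sol K l; have := curve_defect sol; rewrite -/K -/l /=.
rewrite /invariant_curve [vfP _]/= [vfQ _]/= => defect.
split => [[_ /eqP]|defQ].
  rewrite -subr_eq0 defect mulf_eq0 poly_in_x_eq0 (negPf a_neq0) /=.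
  by rewrite subr_eq0 => /eqP.
split; first exact:
  leq_trans (msize_linear_cofactor _ _) (vfdegree_quadratic_system s).
by apply/eqP; rewrite -subr_eq0 defect defQ subrr mulr0.
Qed.

(** Compare coefficients: p2 = x gives p22 = 0 and p21 = 1, after which the two
    coefficients of r give q11 and q10. *)
Lemma associated_ode_laguerre s beta gamma kappa A n :
    associated_ode s beta gamma kappa = laguerre_ode A n ->
  [/\ p2 s = 'X, q11 s = 2 * beta - 1, q10 s = 2 * gamma + A & kappa = n%:R].
Proof.
case=> p2X rE ->; split=> //.
  have p22_0 := congr1 (coefp 2) p2X; have r1 := congr1 (coefp 1) rE.
  move: p22_0 r1; rewrite /= /p2 !(coefE, coefD, coefMX, coefCM, coefXn) /=.
  lra.
have p21_1 := congr1 (coefp 1) p2X; have r0 := congr1 (coefp 0) rE.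
move: p21_1 r0; rewrite /= /p2 !(coefE, coefD, coefMX, coefCM, coefXn) /=.
lra.
Qed.

(** This is the value that [invariant_curve_quadraticP] assigns to Q for the
    data found in [associated_ode_laguerre]. *)
Lemma laguerre_system_factor A beta gamma n :
  vfQ (laguerre_system A beta gamma n) =
    linear_cofactor beta gamma *
      (vary R - (cst (beta - (2 * beta - 1)) * varx R
                 + cst (gamma - (2 * gamma + A))))
    + cst (beta - (2 * beta - 1) + n%:R) * varx R.
Proof. by rewrite /linear_cofactor /cst /=; ring. Qed.

End Curve.

(** * The limit of the hypergeometric systems *)

Section Limit.
Variable R : realType.
Implicit Types (b beta gamma A : R).

(** Substituting x / b for X divides the coefficients of X y and X by b and that
    of X^2 by b^2.  As polynomials in b these coefficients have degree at most
    one, one and two respectively, so that positive powers of b disappear.  In the first component the factor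
    b of x' = b X' plays the same role. *)
Lemma rescale_hypergeometric_system n b A beta gamma : b != 0 ->
  let u := b^-1 in
  let x := varx R in let y := vary R in
  rescale_x b (hypergeometric_system (- n%:R) b (A + 1) (beta * b) gamma) =
  VField
    (vfP (laguerre_system A beta gamma n) + cst u * - x ^+ 2
     + cst (u ^+ 2) * 0)
    (vfQ (laguerre_system A beta gamma n)
     + cst u * (cst (n%:R + 1) * x * y
                + cst (beta * (2 + n%:R) - (n%:R + 1)) * x ^+ 2
                - cst ((1 - gamma) * (n%:R + 1)) * x)
     + cst (u ^+ 2) * (cst (n%:R + 1) * x ^+ 2)).
Proof.
move=> b0 u x y.
have subst_x : subst_div b x = cst u * x by rewrite /subst_div comp_mpolyXU.
have subst_y : subst_div b y = y by rewrite /subst_div comp_mpolyXU.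
have subst_cst e : subst_div b (cst e) = cst e by exact: comp_mpolyC.
have substD : {morph subst_div b : f g / f + g} by exact: comp_mpolyD.
have substM : {morph subst_div b : f g / f * g} by move=> f g; exact: rmorphM.
have substX k : {morph subst_div b : f / f ^+ k} by move=> f; exact: rmorphXn.
have substB : subst_div b (1 - x) = 1 - cst u * x.
  by rewrite -subst_x /subst_div rmorphB rmorph1.
rewrite /rescale_x /=.
rewrite !(substB, substD, substM, substX, subst_x, subst_y, subst_cst).
congr VField.
  have cstbu : cst b * cst u = 1 by rewrite /cst -mpolyCM divff.
  transitivity ((cst b * cst u) * (x - cst u * x ^+ 2)); first by ring.
  by rewrite cstbu /= -/x; ring.
(* The coefficients of X y, X^2 and X before the substitution. *)
pose c1 := 2 * (beta * b) + n%:R - b + 1.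
pose c2 := (beta * b) ^+ 2 + (2 + n%:R - b) * (beta * b)
  - (n%:R + 1) * (b - 1).
pose c3 := (A + 1) * (beta * b) + n%:R * b
  + (1 - gamma) * (- 2 * (beta * b) - 1 - n%:R + b).
have c1E : c1 * u = (2 * beta - 1) + u * (n%:R + 1).
  by rewrite /c1 /u; field.
have c2E : c2 * u ^+ 2 = (beta - 1) * beta
    + u * (beta * (2 + n%:R) - (n%:R + 1)) + u ^+ 2 * (n%:R + 1).
  by rewrite /c2 /u; field.
have c3E : c3 * u = (beta * (A + 2 * gamma - 1) + n%:R + 1 - gamma)
    - u * ((1 - gamma) * (n%:R + 1)).
  by rewrite /c3 /u; field.
rewrite /= -/x -/y.
transitivity (y ^+ 2 + cst (c1 * u) * x * y + cst (2 * gamma + A) * y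
  + cst (A * gamma + gamma ^+ 2) + cst (c2 * u ^+ 2) * x ^+ 2
  + cst (c3 * u) * x).
  by rewrite /c1 /c2 /c3 /cst; ring.
by rewrite c1E c2E c3E /cst; ring.
Qed.

Lemma cvg_inv_quadratic (h : R -> R) (e0 e1 e2 : R) :
  (forall b, b != 0 -> h b = e0 + b^-1 * e1 + b^-1 ^+ 2 * e2) ->
  h b @[b --> pinfty_nbhs R] --> e0.
Proof.
move=> h_inv.
have invr0 : b^-1 @[b --> +oo%R] --> (0 : R).
  by apply/gtr0_cvgV0; [exact: nbhs_pinfty_gt|exact: cvg_id].
have lim : e0 + b^-1 * e1 + b^-1 * b^-1 * e2 @[b --> +oo%R]
    --> e0 + 0 * e1 + 0 * 0 * e2.
  apply: cvgD; last exact: cvgM (cvgM invr0 invr0) (cvg_cst _).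
  by apply: cvgD; [exact: cvg_cst|exact: cvgM invr0 (cvg_cst _)].
rewrite !mul0r !addr0 in lim.
apply: cvg_trans lim; apply: near_eq_cvg; near=> b.
by rewrite h_inv ?expr2 // gt_eqF //; near: b; exact: nbhs_pinfty_gt.
Unshelve. all: by end_near.
Qed.

Lemma cvg_coeffwise_inv_quadratic (V : R -> vfield R) (W : vfield R)
    (f1 f2 g1 g2 : mpoly 2 R) :
  (forall b, b != 0 ->
     V b = VField (vfP W + cst b^-1 * f1 + cst (b^-1 ^+ 2) * f2)
                  (vfQ W + cst b^-1 * g1 + cst (b^-1 ^+ 2) * g2)) ->
  cvg_coeffwise (pinfty_nbhs R) V W.
Proof.
move=> V_inv m; split.
  apply: (@cvg_inv_quadratic _ _ (mcoeff m f1) (mcoeff m f2)) => b /V_inv ->.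
  by rewrite /cst !mcoeffD !mcoeffCM.
apply: (@cvg_inv_quadratic _ _ (mcoeff m g1) (mcoeff m g2)) => b /V_inv ->.
by rewrite /cst !mcoeffD !mcoeffCM.
Qed.

End Limit.

(** * The Laguerre system *)

Theorem corollary7 (R : realType) (A beta gamma : R) (n : nat) (a0 : {poly R})
    (Ha0 : laguerre_poly A n a0) :
  ((exists s : qcoeffs R,
      (exists kappa : R,
         associated_ode s beta gamma kappa = laguerre_ode A n) /\
      quadratic_system s = laguerre_system A beta gamma n) /\
   (forall (s : qcoeffs R) (kappa : R),
      associated_ode s beta gamma kappa = laguerre_ode A n ->
      (invariant_curve (quadratic_system s) (curve s beta gamma a0)
         (linear_cofactor beta gamma)
       <-> quadratic_system s = laguerre_system A beta gamma n)))
  /\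
  cvg_coeffwise (pinfty_nbhs R)
    (fun b : R =>
       rescale_x b (hypergeometric_system (- n%:R) b (A + 1) (beta * b) gamma))
    (laguerre_system A beta gamma n).
Proof.
split; last first.
  apply: cvg_coeffwise_inv_quadratic => b.
  exact: rescale_hypergeometric_system.
case: Ha0 => a0_neq0 _ sol; split; last first.
  move=> s kappa ode_eq.
  have [p2X q11E q10E kappaE] := associated_ode_laguerre ode_eq.
  have sol_s : ode2_solution (associated_ode s beta gamma kappa) a0.
    by rewrite ode_eq.
  have := invariant_curve_quadraticP a0_neq0 sol_s.
  rewrite q11E q10E kappaE p2X poly_in_xX; cbv zeta.
  rewrite -laguerre_system_factor => curveP.
  apply: (iff_trans curveP); split=> [eqQ|-> //].
  rewrite -[LHS]/(VField (poly_in_x (p2 s)) (vfQ (quadratic_system s))).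
  by rewrite eqQ p2X poly_in_xX.
exists (QCoeffs 0 1 0 (2 * beta - 1) (2 * gamma + A) ((beta - 1) * beta)
   (beta * (A + 2 * gamma - 1) + n%:R + 1 - gamma) (A * gamma + gamma ^+ 2)).
split; first by exists n%:R; congr ODE2; rewrite /p2 /=; ring.
congr VField => /=; last by rewrite /cst; ring.
by rewrite /p2 /= !mul0r add0r addr0 mul1r poly_in_xX.
Qed.
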